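(* $$\frac{4301\sqrt3}{256}=\sum_{j=0}^{\infty}\left(\frac14\right)^{j}\frac{\left(\frac32\right)_j\left(\frac73\right)_j\left(\frac83\right)_j}{(1)_j\left(\frac{29}{12}\right)_j\left(\frac{35}{12}\right)_j}\,(9j+16).$$
   Context: $(x)_0=1$ and $(x)_j=x(x+1)\cdots(x+j-1)$ for positive integers $j$ (rising factorial). *)

(* Defs.v *)
From Stdlib Require Import Reals.
From Coquelicot Require Import Coquelicot.

Open Scope R_scope.

(* Rising factorial (x)_j = x (x + 1) ... (x + j - 1), with (x)_0 = 1. *)
Fixpoint rising (x : R) (j : nat) : R :=
  match j with
  | O => 1
  | S k => rising x k * (x + INR k)
  end.

(* Main.v *)
Require Import Defs.
From Stdlib Require Import Reals Lra Lia.
From Coquelicot Require Import Coquelicot.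

Open Scope R_scope.

(** The series is [16 * S (16 / 3)] for the family
    [S a = sum_k (1 + 3 k / a) 4^(-k) (a/2)_k (a-3)_k (3/2)_k
           / (k! (a/2 + 1/4)_k (a/2 - 1/4)_k)],
    which is [sum_k (1 + 3 k / a) 4^(-k) (a/2)_k (b)_k (c)_k (e)_k
       / (k! ((a+2-b)/2)_k ((a+2-c)/2)_k ((a+2-e)/2)_k)] with
    [b + c + e = a + 1] at [c = 3/2], [e = 5/2], [b = a - 3], where
    [e = (a+2-b)/2] cancels: a quadratic sum of the kind studied by Gasper and
    Rahman, whose closed form is a quotient of gamma values.

    - A Wilf-Zeilberger certificate ([wz_pair]) makes the summand for [a + 2],
      times [(a^2 - 4) / (a^2 - 1/4)], differ from the summand for [a] by a
      telescoping term; hence [Series_term_shift],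
      [S a = (a^2 - 4) / (a^2 - 1/4) * S (a + 2)].

    - As [a] tends to infinity, [S a] tends to a positive number which is
      the same along [16/3 + 2 n] and along [3 + 2 n] ([Series_term_lim]).
      Since [S 3 = 1] (the factor [a - 3] kills every term but the first), this
      common limit cancels and [S (16/3)] is the limit of the quotient of the
      two finite products that come from the recurrence ([shift_prod_lim]).

    - That quotient is, up to a rational function of [n]
      ([shift_prod_ratio]), the product of a duplication factor
      [dup_ratio (2 n) / dup_ratio n], which tends to 1, and of
      [prod_(1 <= i <= n) (i^2 - 1/9) / (i^2 - 1/4)].  The latter tends to
      [3 sqrt 3 / 4], because it links the integrals of
      [cos (b t) cos^(2 n) t] from 0 to [pi / 2] for [b = 2/3] and [b = 1], whose
      quotient is elementary at [n = 0] and tends to 1 ([sine_prod_lim]). *)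

Lemma lim_shift_ratio (c d : R) : 0 < d ->
  is_lim_seq (fun n => (INR n + c) / (INR n + d)) 1.
Proof.
  intros Hd.
  apply is_lim_seq_ext with (fun n => 1 + (c - d) * / (INR n + d)).
  { intros n. generalize (pos_INR n); intros. field. lra. }
  replace (Finite 1) with (Rbar_plus 1 ((c - d) * 0)) by (simpl; f_equal; ring).
  apply is_lim_seq_plus'; [apply is_lim_seq_const|].
  apply is_lim_seq_mult'; [apply is_lim_seq_const|].
  replace (Finite 0) with (Rbar_inv p_infty) by reflexivity.
  apply is_lim_seq_inv; [|discriminate].
  eapply is_lim_seq_plus; [apply is_lim_seq_INR|apply (is_lim_seq_const d)|reflexivity].
Qed.

(** * A quotient of sine products *)

Definition cosint (b : R) (n : nat) : R :=
  RInt (fun t => cos (b * t) * cos t ^ n) 0 (PI / 2).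

Lemma cosint_ex (b : R) (n : nat) :
  ex_RInt (fun t => cos (b * t) * cos t ^ n) 0 (PI / 2).
Proof.
  apply (ex_RInt_continuous (V := R_CompleteNormedModule)).
  intros t _. apply (ex_derive_continuous (V := R_NormedModule)). auto_derive. exact I.
Qed.

(** Both sides differ by the integral of the derivative of
    [y' c - y c'], where [y t = cos t ^ (n + 2)] and [c t = cos (b t)]
    satisfy second-order equations; the boundary values vanish. *)
Lemma cosint_rec (b : R) (n : nat) :
  ((INR n + 2) ^ 2 - b ^ 2) * cosint b (n + 2)
  = (INR n + 2) * (INR n + 1) * cosint b n.
Proof.
  set (f := fun m t => cos (b * t) * cos t ^ m).
  (* [H] is y' c - y c'. *)
  set (H := fun t => - (INR n + 2) * (cos t ^ S n * sin t * cos (b * t))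
                     + b * (cos t ^ (n + 2) * sin (b * t))).
  set (h := fun t => minus (scal ((INR n + 2) * (INR n + 1)) (f n t))
                       (scal ((INR n + 2) ^ 2 - b ^ 2) (f (n + 2)%nat t))).
  assert (E1 : is_RInt h 0 (PI / 2) (minus (H (PI / 2)) (H 0))).
  { apply (is_RInt_derive (V := R_CompleteNormedModule)).
    - intros t _. unfold H, h, f, minus, plus, opp, scal; simpl.
      unfold mult; simpl.
      auto_derive; [exact I|].
      replace (n + 2)%nat with (S (S n)) by lia.
      assert (Hs : sin t * sin t = 1 - cos t * cos t)
        by (generalize (sin2_cos2 t); unfold Rsqr; lra).
      rewrite !S_INR. simpl pred. simpl pow.
      match goal with |- ?l = ?r =>
        assert (Hd : l - r = (INR n + 2) * (INR n + 1) * cos t ^ n * cos (b * t)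
                       * (sin t * sin t - (1 - cos t * cos t))) end.
      { destruct n; [simpl; ring|]. rewrite ?S_INR. simpl pow. simpl pred. ring. }
      rewrite Hs in Hd. lra.
    - intros t _. apply (ex_derive_continuous (V := R_NormedModule)).
      unfold h, f, minus, plus, opp, scal; simpl. unfold mult; simpl.
      auto_derive. exact I. }
  assert (E2 : is_RInt h 0 (PI / 2)
     (minus (scal ((INR n + 2) * (INR n + 1)) (cosint b n))
            (scal ((INR n + 2) ^ 2 - b ^ 2) (cosint b (n + 2))))).
  { apply (is_RInt_minus (V := R_NormedModule)); apply (is_RInt_scal (V := R_NormedModule));
      apply (RInt_correct (V := R_CompleteNormedModule)), cosint_ex. }
  assert (E := eq_trans (eq_sym (is_RInt_unique _ _ _ _ E1)) (is_RInt_unique _ _ _ _ E2)).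
  unfold H, minus, plus, opp, scal in E; simpl in E. unfold mult in E; simpl in E.
  rewrite cos_PI2, (Rmult_0_r b), sin_0 in E.
  replace (n + 2)%nat with (S (S n)) in E |- * by lia. simpl in E. simpl pow. lra.
Qed.

Lemma cosint_le (b c : R) (m n : nat) :
  (forall t, 0 < t < PI / 2 -> cos (b * t) * cos t ^ m <= cos (c * t) * cos t ^ n) ->
  cosint b m <= cosint c n.
Proof.
  intros H. apply RInt_le; try apply cosint_ex; auto.
  generalize PI_RGT_0; lra.
Qed.

Lemma cosint_0 (b : R) : b <> 0 -> cosint b 0 = sin (b * (PI / 2)) / b.
Proof.
  intros Hb. apply is_RInt_unique.
  replace (sin (b * (PI / 2)) / b) with (minus (sin (b * (PI / 2)) / b) (sin (b * 0) / b)).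
  2: { unfold minus, plus, opp; simpl. rewrite Rmult_0_r, sin_0. field; auto. }
  apply (is_RInt_derive (V := R_CompleteNormedModule) (fun t => sin (b * t) / b)).
  - intros t _. auto_derive; auto. simpl. field; auto.
  - intros t _. apply (ex_derive_continuous (V := R_NormedModule)). auto_derive. exact I.
Qed.

(** The quotient of the partial sine products [prod (1 - x^2 / i^2)] at
    [x = 1/3] and at [x = 1/2]. *)
Fixpoint sine_prod (n : nat) : R :=
  match n with
  | O => 1
  | S k => sine_prod k * (((INR k + 1) ^ 2 - 1 / 9) / ((INR k + 1) ^ 2 - 1 / 4))
  end.

(** The recurrences for [b = 2/3] and [b = 1] carry the same factor
    [(m + 2) (m + 1)], which cancels in the quotient and leaves the factor of
    [sine_prod]; the constant is the quotient of the two integrals for [n = 0]. *)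
Lemma sine_prod_cosint (n : nat) :
  sine_prod n * cosint (2 / 3) (2 * n) = 3 * sqrt 3 / 4 * cosint 1 (2 * n).
Proof.
  induction n as [|n IH].
  - simpl. rewrite !cosint_0 by lra.
    replace (2 / 3 * (PI / 2)) with (PI / 3) by field.
    rewrite (Rmult_1_l (PI / 2)), sin_PI2, sin_PI3. field.
  - replace (2 * S n)%nat with (2 * n + 2)%nat by lia.
    assert (E1 := cosint_rec (2 / 3) (2 * n)). assert (E2 := cosint_rec 1 (2 * n)).
    rewrite mult_INR in E1, E2. simpl (INR 2) in E1, E2. replace (1 + 1) with 2 in E1, E2 by ring.
    assert (Hn := pos_INR n).
    simpl sine_prod.
    set (x := cosint (2 / 3) (2 * n)) in *. set (y := cosint 1 (2 * n)) in *.
    set (N := INR n) in *.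
    assert (A1 : cosint (2 / 3) (2 * n + 2)
       = (2 * N + 2) * (2 * N + 1) * x / ((2 * N + 2) ^ 2 - (2 / 3) ^ 2)).
    { apply (Rmult_eq_reg_l ((2 * N + 2) ^ 2 - (2 / 3) ^ 2)); [|nra].
      rewrite E1. field. nra. }
    assert (A2 : cosint 1 (2 * n + 2)
       = (2 * N + 2) * (2 * N + 1) * y / ((2 * N + 2) ^ 2 - 1 ^ 2)).
    { apply (Rmult_eq_reg_l ((2 * N + 2) ^ 2 - 1 ^ 2)); [|nra].
      rewrite E2. field. nra. }
    rewrite A1, A2.
    transitivity (sine_prod n * x * ((2 * N + 2) * (2 * N + 1) / (4 * ((N + 1) ^ 2 - 1 / 4)))).
    + field. repeat split; nra.
    + rewrite IH. field. repeat split; nra.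
Qed.

(** Between 0 and [pi / 2], [cos t <= cos (2 t / 3) <= 1], so the integral for
    [b = 2/3] lies between the integrals of [cos ^ (2 n + 1)] and of
    [cos ^ (2 n)].  The former is at least the integral of [cos ^ (2 n + 2)],
    which the recurrence for [b = 0] compares with the latter. *)
Lemma sine_prod_bounds (n : nat) :
  3 * sqrt 3 / 4 * ((2 * INR n + 1) / (2 * INR n + 2)) <= sine_prod n <= 3 * sqrt 3 / 4.
Proof.
  assert (Hpi := PI_RGT_0).
  assert (Hc : forall t, 0 < t < PI / 2 -> 0 < cos t < 1 /\ 0 <= cos t ^ (2 * n)
             /\ cos t <= cos (2 / 3 * t) <= 1).
  { intros t Ht.
    assert (0 < cos t) by (apply cos_gt_0; lra).
    assert (cos t < 1) by (rewrite <- cos_0; apply cos_decreasing_1; lra).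
    assert (cos t < cos (2 / 3 * t)) by (apply cos_decreasing_1; lra).
    assert (0 <= cos t ^ (2 * n)) by (apply pow_le; lra).
    generalize (COS_bound (2 / 3 * t)). lra. }
  assert (H1 : cosint 1 (2 * n) <= cosint (2 / 3) (2 * n)).
  { apply cosint_le; intros t Ht. destruct (Hc t Ht) as (?&?&?). rewrite (Rmult_1_l t). nra. }
  assert (H2 : cosint (2 / 3) (2 * n) <= cosint 0 (2 * n)).
  { apply cosint_le; intros t Ht. destruct (Hc t Ht) as (?&?&?).
    rewrite Rmult_0_l, cos_0. nra. }
  assert (H3 : cosint 0 (2 * n + 2) <= cosint 1 (2 * n)).
  { apply cosint_le; intros t Ht. destruct (Hc t Ht) as (?&?&?).
    rewrite Rmult_0_l, cos_0, (Rmult_1_l t), pow_add. simpl (cos t ^ 2).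
    assert (cos t * cos t <= cos t) by nra. nra. }
  assert (H0 : 0 < cosint (2 / 3) (2 * n)).
  { apply RInt_gt_0; [lra| |].
    - intros t Ht. destruct (Hc t Ht) as (?&?&?).
      apply Rmult_lt_0_compat; [lra|apply pow_lt; lra].
    - intros t _. apply (ex_derive_continuous (V := R_NormedModule)). auto_derive. exact I. }
  assert (E := cosint_rec 0 (2 * n)). rewrite mult_INR in E. simpl (INR 2) in E. replace (1 + 1) with 2 in E by ring.
  assert (Hn := pos_INR n). set (N := INR n) in *.
  assert (E' : cosint 0 (2 * n + 2) = (2 * N + 1) / (2 * N + 2) * cosint 0 (2 * n)).
  { apply (Rmult_eq_reg_l ((2 * N + 2) ^ 2)); [|nra].
    replace ((2 * N + 2) ^ 2) with ((2 * N + 2) ^ 2 - 0 ^ 2) at 1 by ring.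
    rewrite E. field. lra. }
  assert (Hq : 0 < (2 * N + 1) / (2 * N + 2)) by (apply Rdiv_lt_0_compat; lra).
  assert (V := sine_prod_cosint n).
  assert (Hs : 0 < 3 * sqrt 3 / 4) by (generalize (sqrt_lt_R0 3); lra).
  set (s := 3 * sqrt 3 / 4) in *. set (q := (2 * N + 1) / (2 * N + 2)) in *.
  split; apply (Rmult_le_reg_r (cosint (2 / 3) (2 * n))); auto; rewrite V.
  - rewrite Rmult_assoc. apply Rmult_le_compat_l; [lra|]. nra.
  - apply Rmult_le_compat_l; lra.
Qed.

Lemma sine_prod_lim : is_lim_seq sine_prod (3 * sqrt 3 / 4).
Proof.
  apply is_lim_seq_le_le with
    (u := fun n => 3 * sqrt 3 / 4 * ((INR n + 1 / 2) / (INR n + 1)))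
    (w := fun _ => 3 * sqrt 3 / 4).
  - intros n. assert (B := sine_prod_bounds n). assert (Hn := pos_INR n).
    replace ((INR n + 1 / 2) / (INR n + 1)) with ((2 * INR n + 1) / (2 * INR n + 2))
      by (field; lra). exact B.
  - replace (Finite (3 * sqrt 3 / 4)) with (Finite (3 * sqrt 3 / 4 * 1)) by (f_equal; ring).
    apply is_lim_seq_mult'; [apply is_lim_seq_const|apply lim_shift_ratio; lra].
  - apply is_lim_seq_const.
Qed.

(** * The parametric summand and its Wilf-Zeilberger certificate *)

Lemma rising_S_l (x : R) (j : nat) : rising x (S j) = x * rising (x + 1) j.
Proof.
  induction j as [|j IH]; [simpl; ring|].
  change (rising x (S (S j))) with (rising x (S j) * (x + INR (S j))).
  rewrite IH, S_INR. simpl. ring.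
Qed.

Lemma rising_pos (x : R) (j : nat) : 0 < x -> 0 < rising x j.
Proof.
  intros Hx. induction j as [|j IH]; simpl; [lra|].
  apply Rmult_lt_0_compat; [exact IH|]. generalize (pos_INR j); lra.
Qed.

(** The factor of the summand that depends on the parameter [a]; the summand
    uses [s = 3] and its certificate [s = 2]. *)
Definition varying (a s : R) (k : nat) : R :=
  (1 / 4) ^ k * (rising (a / 2) k * rising (a - s) k)
  / (rising (a / 2 + 1 / 4) k * rising (a / 2 - 1 / 4) k).

Definition fixed (k : nat) : R := rising (3 / 2) k / rising 1 k.

Definition term (a : R) (k : nat) : R :=
  (1 + 3 * INR k / a) * fixed k * varying a 3 k.

(** For [a] other than 3 this is [- k (2 k + 3) / (a (a - 3))] times the summand
    without its factor [1 + 3 k / a], as found by Gosper's algorithm.  In the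
    form below the division by [a - 3] has been carried out inside the rising
    factorial [(a - 3)_k], because the case [a = 3] is the starting point of the
    whole evaluation. *)
Definition wz_cert (a : R) (k : nat) : R :=
  match k with
  | O => 0
  | S j => - ((2 * INR j + 5) / a) * ((INR j + 1) * fixed (S j)) * varying a 2 j
           * ((a / 2 + INR j) / (4 * ((a / 2 + INR j) ^ 2 - 1 / 16)))
  end.

Lemma varying_0 (a s : R) : varying a s 0 = 1.
Proof. unfold varying; simpl; field. Qed.

Lemma varying_S (a s : R) (k : nat) : 3 <= a ->
  varying a s (S k)
  = varying a s k * ((a / 2 + INR k) * (a - s + INR k)
                    / (4 * ((a / 2 + INR k) ^ 2 - 1 / 16))).
Proof.
  intros Ha. assert (Hk := pos_INR k). unfold varying. simpl.
  assert (H1 := rising_pos (a / 2 + 1 / 4) k ltac:(lra)).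
  assert (H2 := rising_pos (a / 2 - 1 / 4) k ltac:(lra)).
  field. repeat split; nra.
Qed.

Lemma fixed_S (k : nat) : fixed (S k) = fixed k * ((3 / 2 + INR k) / (1 + INR k)).
Proof.
  unfold fixed; simpl. assert (Hk := pos_INR k).
  assert (H1 := rising_pos 1 k ltac:(lra)). field. lra.
Qed.

(** This lemma and [varying_3_2] express the summands for [a + 2] and for [a]
    through [varying a 2], the factor in which the certificate is written. *)
Lemma varying_shift (a : R) (k : nat) : 3 <= a ->
  varying (a + 2) 3 k
  = varying a 2 k * ((a - 2 + INR k) * (a + 2 * INR k) * (a ^ 2 - 1 / 4)
      / (4 * a * (a - 2) * ((a / 2 + INR k) ^ 2 - 1 / 16))).
Proof.
  intros Ha. assert (Hk := pos_INR k). unfold varying.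
  assert (E : forall x, 0 < x -> rising (x + 1) k = rising x k * (x + INR k) / x).
  { intros x Hx. apply (Rmult_eq_reg_l x); [|lra]. rewrite <- rising_S_l. simpl. field. lra. }
  replace ((a + 2) / 2 + 1 / 4) with ((a / 2 + 1 / 4) + 1) by field.
  replace ((a + 2) / 2 - 1 / 4) with ((a / 2 - 1 / 4) + 1) by field.
  replace ((a + 2) / 2) with (a / 2 + 1) by field.
  replace (a + 2 - 3) with (a - 2 + 1) by ring.
  rewrite !E by lra.
  assert (H1 := rising_pos (a / 2 + 1 / 4) k ltac:(lra)).
  assert (H2 := rising_pos (a / 2 - 1 / 4) k ltac:(lra)).
  field. repeat split; nra.
Qed.

Lemma varying_3_2 (a : R) (k : nat) :
  varying a 3 k * (a - 3 + INR k) = (a - 3) * varying a 2 k.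
Proof.
  assert (E : rising (a - 3) k * (a - 3 + INR k) = (a - 3) * rising (a - 2) k).
  { change (rising (a - 3) (S k) = (a - 3) * rising (a - 2) k).
    rewrite rising_S_l. f_equal. f_equal. ring. }
  unfold varying, Rdiv.
  transitivity ((1 * / 4) ^ k * (rising (a * / 2) k * (rising (a - 3) k * (a - 3 + INR k)))
     * / (rising (a * / 2 + 1 * / 4) k * rising (a * / 2 - 1 * / 4) k)); [ring|].
  rewrite E. ring.
Qed.

(** After division by [fixed j] and [varying a 2 j] (with [k = j + 1]) this is an
    identity of rational functions of [a] and [j]. *)
Lemma wz_pair (a : R) (k : nat) : 3 <= a ->
  (a ^ 2 - 4) / (a ^ 2 - 1 / 4) * term (a + 2) k - term a k = wz_cert a (S k) - wz_cert a k.
Proof.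
  intros Ha. unfold term. rewrite varying_shift by auto.
  destruct k as [|j].
  - unfold wz_cert. rewrite fixed_S. simpl INR.
    rewrite !varying_0.
    field. repeat split; nra.
  - assert (Hj := pos_INR j). unfold wz_cert.
    assert (E : varying a 3 (S j) = (a - 3) * varying a 2 j
        * ((a / 2 + INR j) / (4 * ((a / 2 + INR j) ^ 2 - 1 / 16)))).
    { rewrite varying_S, <- varying_3_2 by auto. field. nra. }
    rewrite E, (fixed_S (S j)), (varying_S a 2 j), (fixed_S j) by auto. rewrite !S_INR.
    field. repeat split; nra.
Qed.

(** * Behaviour for large values of the parameter *)

(** A single summable majorant serves for the summand, its deviation from the
    limit as [a] grows, and the certificate. *)
Definition majorant (k : nat) : R := (INR k + 1) ^ 3 / 2 ^ k.

Lemma ex_series_majorant : ex_series majorant.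
Proof.
  assert (Hd : forall k, 0 < majorant k).
  { intros k. apply Rdiv_lt_0_compat; apply pow_lt; generalize (pos_INR k); lra. }
  apply ex_series_ext with (fun k => Rabs (majorant k)).
  { intros k. apply Rabs_pos_eq, Rlt_le, Hd. }
  apply ex_series_DAlembert with (1 / 2); [lra| |].
  - intros k. generalize (Hd k); lra.
  - apply is_lim_seq_ext with (fun k =>
      1 / 2 * ((INR k + 2) / (INR k + 1) * ((INR k + 2) / (INR k + 1) * ((INR k + 2) / (INR k + 1))))).
    + intros k. rewrite Rabs_pos_eq.
      * unfold majorant. rewrite S_INR. simpl (2 ^ S k).
        assert (0 < 2 ^ k) by (apply pow_lt; lra). assert (Hk := pos_INR k).
        field. lra.
      * apply Rlt_le, Rdiv_lt_0_compat; auto.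
    + assert (L : is_lim_seq (fun k => (INR k + 2) / (INR k + 1)) 1)
        by (apply lim_shift_ratio; lra).
      replace (Finite (1 / 2)) with (Finite (1 / 2 * (1 * (1 * 1)))) by (f_equal; ring).
      repeat (apply is_lim_seq_mult'; [first [apply is_lim_seq_const | exact L]|]). exact L.
Qed.

Lemma fixed_bounds (k : nat) : 0 < fixed k <= INR k + 1.
Proof.
  induction k as [|k IH]; [unfold fixed; simpl; lra|].
  assert (Hk := pos_INR k). rewrite fixed_S, S_INR. split.
  - apply Rmult_lt_0_compat; [lra|]. apply Rdiv_lt_0_compat; lra.
  - apply Rle_trans with ((INR k + 1) * ((3 / 2 + INR k) / (1 + INR k))).
    + apply Rmult_le_compat_r; [|lra]. apply Rlt_le, Rdiv_lt_0_compat; lra.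
    + replace ((INR k + 1) * ((3 / 2 + INR k) / (1 + INR k))) with (3 / 2 + INR k)
        by (field; lra). lra.
Qed.

(** Each factor of [varying] is at most 1/2. *)
Lemma varying_le (a s : R) (k : nat) : 3 <= a -> 2 <= s <= 3 ->
  0 <= varying a s k <= / 2 ^ k.
Proof.
  intros Ha Hs. induction k as [|k IH]; [rewrite varying_0; simpl; lra|].
  assert (Hk := pos_INR k). rewrite varying_S by auto. simpl (2 ^ S k).
  assert (H2 : 0 < 2 ^ k) by (apply pow_lt; lra).
  assert (H0 : 0 < 4 * ((a / 2 + INR k) ^ 2 - 1 / 16)) by nra.
  assert (Hf : 0 <= (a / 2 + INR k) * (a - s + INR k)
                    / (4 * ((a / 2 + INR k) ^ 2 - 1 / 16)) <= / 2).
  { split.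
    - apply Rdiv_le_0_compat; nra.
    - apply Rle_div_l; [lra|].
      assert (0 <= (a / 2 + INR k) * (2 * (a / 2 + INR k) - 2 - (a - s + INR k)))
        by (apply Rmult_le_pos; lra).
      nra. }
  split; [nra|]. rewrite Rinv_mult, (Rmult_comm (/ 2)).
  apply Rmult_le_compat; lra.
Qed.

(** With [u = a / 2 + k], the factor of index [k] is at least
    [(1 - (3 + k) / u) / 2], hence at least [(1 - 2 (3 + k) / a) / 2]; the
    deficits of the factors add up to at most [2 k (k + 3) / a]. *)
Lemma varying_ge (a : R) (k : nat) : 3 <= a ->
  (1 - 2 * INR k * (INR k + 3) / a) * / 2 ^ k <= varying a 3 k.
Proof.
  intros Ha. induction k as [|k IH]; [rewrite varying_0; simpl; lra|].
  assert (Hk := pos_INR k). assert (HP := varying_le a 3 k Ha ltac:(lra)).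
  rewrite varying_S by auto. simpl (2 ^ S k). rewrite S_INR.
  assert (H2 : 0 < 2 ^ k) by (apply pow_lt; lra).
  set (P := varying a 3 k) in *. set (x := INR k) in *.
  assert (H0 : 0 < 4 * ((a / 2 + x) ^ 2 - 1 / 16)) by nra.
  set (d := 2 * (3 + x) / a).
  assert (Hd : 0 <= d) by (apply Rdiv_le_0_compat; lra).
  assert (Hf : (1 - d) / 2 <= (a / 2 + x) * (a - 3 + x) / (4 * ((a / 2 + x) ^ 2 - 1 / 16))).
  { apply (Rle_div_r _ _ (4 * ((a / 2 + x) ^ 2 - 1 / 16))); [lra|].
    assert (Hda : d * a = 2 * (3 + x)) by (unfold d; field; lra).
    assert (Hdu : 3 + x <= d * (a / 2 + x)) by nra.
    replace (a - 3 + x) with (2 * (a / 2 + x) - 3 - x) by field.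
    assert (Hu : 3 / 2 <= a / 2 + x) by lra.
    clearbody d. set (u := a / 2 + x) in *. clearbody u.
    assert (0 <= (d * u - (3 + x)) * u) by (apply Rmult_le_pos; lra).
    assert (0 <= d * (u ^ 2 - 1 / 8)) by (apply Rmult_le_pos; nra).
    nra. }
  apply Rle_trans with (P * ((1 - d) / 2)); [|apply Rmult_le_compat_l; lra].
  assert (Hi : 0 < / 2 ^ k) by (apply Rinv_0_lt_compat; auto).
  rewrite Rinv_mult.
  assert (HdP : d * P <= d * / 2 ^ k) by (apply Rmult_le_compat_l; lra).
  assert (E : 2 * (x + 1) * (x + 1 + 3) / a
              = 2 * x * (x + 3) / a + d + 2 * (1 + x) / a)
    by (unfold d; field; lra).
  assert (0 <= 2 * (1 + x) / a) by (apply Rdiv_le_0_compat; lra).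
  rewrite E. nra.
Qed.

Lemma term_le (a : R) (k : nat) : 3 <= a -> 0 <= term a k <= 3 * majorant k.
Proof.
  intros Ha. assert (Hk := pos_INR k). assert (W := fixed_bounds k).
  assert (P := varying_le a 3 k Ha ltac:(lra)). unfold term, majorant.
  assert (D : 0 <= 3 * INR k / a <= 3 * INR k).
  { split; [apply Rdiv_le_0_compat; lra|]. apply Rle_div_l; nra. }
  split.
  - apply Rmult_le_pos; [apply Rmult_le_pos|]; lra.
  - replace (3 * ((INR k + 1) ^ 3 / 2 ^ k)) with (3 * (INR k + 1) ^ 3 * / 2 ^ k)
      by (unfold Rdiv; ring).
    apply Rmult_le_compat; [apply Rmult_le_pos; lra|lra| |lra].
    apply Rle_trans with ((1 + 3 * INR k) * (INR k + 1)).
    + apply Rmult_le_compat; lra.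
    + nra.
Qed.

Lemma ex_series_term (a : R) : 3 <= a -> ex_series (term a).
Proof.
  intros Ha. apply (ex_series_le (K := R_AbsRing) (V := R_CompleteNormedModule))
    with (fun k => 3 * majorant k).
  - intros k. assert (B := term_le a k Ha).
    change (Rabs (term a k) <= 3 * majorant k). rewrite Rabs_pos_eq; lra.
  - apply (ex_series_scal (V := R_NormedModule)), ex_series_majorant.
Qed.

(** The limit of [term a k] as [a] tends to infinity, a term of the
    binomial series of [(1 - x) ^ (- 3/2)] at [x = 1/2]. *)
Definition limit_term (k : nat) : R := fixed k * / 2 ^ k.

Lemma term_limit_term (a : R) (k : nat) : 3 <= a ->
  Rabs (term a k - limit_term k) <= 9 / a * majorant k.
Proof.
  intros Ha. assert (Hk := pos_INR k). assert (W := fixed_bounds k).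
  assert (P := varying_le a 3 k Ha ltac:(lra)). assert (Q := varying_ge a k Ha).
  unfold term, limit_term, majorant.
  assert (Hi : 0 < / 2 ^ k) by (apply Rinv_0_lt_compat, pow_lt; lra).
  assert (Hv : 0 < / a) by (apply Rinv_0_lt_compat; lra).
  unfold Rdiv in *. set (x := INR k) in *. set (w := fixed k) in *.
  set (p := varying a 3 k) in *. set (h := / 2 ^ k) in *. set (v := / a) in *.
  assert (B : Rabs ((1 + 3 * x * v) * p - h) <= (2 * x * (x + 3) + 3 * x) * v * h).
  { assert (0 <= 3 * x * v) by (apply Rmult_le_pos; lra).
    assert (0 <= 2 * x * (x + 3) * v) by (apply Rmult_le_pos; nra).
    apply Rabs_le. split; nra. }
  replace ((1 + 3 * x * v) * w * p - w * h) with (w * ((1 + 3 * x * v) * p - h)) by ring.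
  rewrite Rabs_mult, (Rabs_pos_eq w) by lra.
  apply Rle_trans with ((x + 1) * ((2 * x * (x + 3) + 3 * x) * v * h)).
  - apply Rmult_le_compat; try lra. apply Rabs_pos.
  - assert (0 <= v * h) by (apply Rmult_le_pos; lra).
    assert ((x + 1) * (2 * x * (x + 3) + 3 * x) <= 9 * (x + 1) ^ 3) by nra.
    nra.
Qed.

Lemma ex_series_limit_term : ex_series limit_term.
Proof.
  apply (ex_series_le (K := R_AbsRing) (V := R_CompleteNormedModule)) with majorant.
  - intros k. assert (W := fixed_bounds k). assert (Hk := pos_INR k).
    change (Rabs (limit_term k) <= majorant k). unfold limit_term, majorant, Rdiv.
    assert (Hi : 0 < / 2 ^ k) by (apply Rinv_0_lt_compat, pow_lt; lra).
    rewrite Rabs_pos_eq by (apply Rmult_le_pos; lra).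
    apply Rmult_le_compat_r; [lra|]. nra.
  - exact ex_series_majorant.
Qed.

Lemma Series_term_lim (a : R) : 3 <= a ->
  Rabs (Series (term a) - Series limit_term) <= 9 / a * Series majorant.
Proof.
  intros Ha. rewrite <- Series_minus, <- Series_scal_l
    by (apply ex_series_term || apply ex_series_limit_term; auto).
  assert (X : ex_series (fun k => 9 / a * majorant k))
    by apply (ex_series_scal (V := R_NormedModule)), ex_series_majorant.
  assert (X' : ex_series (fun k => Rabs (term a k - limit_term k))).
  { apply (ex_series_le (K := R_AbsRing) (V := R_CompleteNormedModule))
      with (fun k => 9 / a * majorant k); auto.
    intros k. change (Rabs (Rabs (term a k - limit_term k)) <= 9 / a * majorant k).
    rewrite Rabs_Rabsolu. apply term_limit_term; auto. }
  apply Rle_trans with (Series (fun k => Rabs (term a k - limit_term k))).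
  - apply Series_Rabs, X'.
  - apply Series_le; auto. intros k. split; [apply Rabs_pos|apply term_limit_term; auto].
Qed.

Lemma Series_limit_term_pos : 0 < Series limit_term.
Proof.
  assert (P : forall k, 0 < limit_term k).
  { intros k. apply Rmult_lt_0_compat; [apply fixed_bounds|].
    apply Rinv_0_lt_compat, pow_lt; lra. }
  rewrite Series_incr_1 by exact ex_series_limit_term.
  assert (0 <= Series (fun k => limit_term (S k))).
  { replace 0 with (Series (fun _ => 0 * 0)) by (rewrite Series_scal_l; ring).
    apply Series_le.
    - intros k. generalize (P (S k)); lra.
    - apply (ex_series_incr_1 limit_term), ex_series_limit_term. }
  generalize (P 0%nat); lra.
Qed.

Lemma wz_cert_lim (a : R) : 3 <= a -> is_lim_seq (wz_cert a) 0.
Proof.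
  intros Ha. apply is_lim_seq_incr_1.
  assert (D : is_lim_seq (fun k => 4 * majorant k) 0).
  { replace (Finite 0) with (Finite (4 * 0)) by (f_equal; ring).
    apply is_lim_seq_mult'; [apply is_lim_seq_const|].
    apply ex_series_lim_0, ex_series_majorant. }
  apply is_lim_seq_abs_0, is_lim_seq_le_le with (u := fun _ => 0) (w := fun k => 4 * majorant k);
    [|apply is_lim_seq_const|exact D].
  intros j. split; [apply Rabs_pos|]. unfold wz_cert, majorant.
  assert (Hj := pos_INR j). assert (W := fixed_bounds (S j)). rewrite S_INR in W.
  assert (P := varying_le a 2 j Ha ltac:(lra)).
  assert (B1 : 0 <= (2 * INR j + 5) / a <= 5 / 3 * (INR j + 1)).
  { split; [apply Rdiv_le_0_compat; lra|apply Rle_div_l; nra]. }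
  assert (B2 : 0 <= (a / 2 + INR j) / (4 * ((a / 2 + INR j) ^ 2 - 1 / 16)) <= 1).
  { assert (0 < 4 * ((a / 2 + INR j) ^ 2 - 1 / 16)) by nra.
    split; [apply Rdiv_le_0_compat; lra|apply Rle_div_l; nra]. }
  set (x := INR j) in *. set (w := fixed (S j)) in *. set (p := varying a 2 j) in *.
  set (q := (2 * x + 5) / a) in *.
  set (r := (a / 2 + x) / (4 * ((a / 2 + x) ^ 2 - 1 / 16))) in *.
  replace (- q * ((x + 1) * w) * p * r) with (- (q * ((x + 1) * w) * p * r)) by ring.
  assert (Z1 : 0 <= (x + 1) * w) by (apply Rmult_le_pos; lra).
  assert (Z2 : 0 <= q * ((x + 1) * w)) by (apply Rmult_le_pos; lra).
  assert (Z3 : 0 <= q * ((x + 1) * w) * p) by (apply Rmult_le_pos; lra).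
  rewrite Rabs_Ropp, Rabs_pos_eq by (apply Rmult_le_pos; lra).
  apply Rle_trans with (q * ((x + 1) * w) * p); [nra|].
  replace (4 * ((x + 1) ^ 3 / 2 ^ j)) with (4 * (x + 1) ^ 3 * / 2 ^ j)
    by (unfold Rdiv; ring).
  apply Rmult_le_compat; try lra.
  apply Rle_trans with (5 / 3 * (x + 1) * ((x + 1) * (x + 1 + 1))).
  - apply Rmult_le_compat; try lra. apply Rmult_le_compat_l; lra.
  - nra.
Qed.

Lemma Series_term_shift (a : R) : 3 <= a ->
  Series (term a) = (a ^ 2 - 4) / (a ^ 2 - 1 / 4) * Series (term (a + 2)).
Proof.
  intros Ha. set (c := (a ^ 2 - 4) / (a ^ 2 - 1 / 4)).
  assert (X := ex_series_term a Ha). assert (X2 := ex_series_term (a + 2) ltac:(lra)).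
  assert (T : is_series (fun k => c * term (a + 2) k - term a k) 0).
  { change (is_lim_seq (sum_n (fun k => c * term (a + 2) k - term a k)) 0).
    apply is_lim_seq_ext with (fun n => wz_cert a (S n)).
    - induction n as [|n IH].
      + rewrite sum_O. unfold c. rewrite wz_pair by auto. simpl. ring.
      + rewrite sum_Sn, <- IH. unfold c. rewrite wz_pair by auto.
        unfold plus; simpl. ring.
    - apply (is_lim_seq_incr_1 (wz_cert a)), wz_cert_lim, Ha. }
  apply is_series_unique in T. rewrite Series_minus, Series_scal_l in T; auto.
  - lra.
  - apply (ex_series_scal (V := R_NormedModule)), X2.
Qed.

(** * Evaluation of the limit *)

(** The product that accumulates when the recurrence of [Series_term_shift] is
    applied [n] times from [a]. *)
Fixpoint shift_prod (a : R) (n : nat) : R :=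
  match n with
  | O => 1
  | S k => shift_prod a k * (((a + 2 * INR k) ^ 2 - 4) / ((a + 2 * INR k) ^ 2 - 1 / 4))
  end.

Lemma shift_prod_pos (a : R) (n : nat) : 3 <= a -> 0 < shift_prod a n.
Proof.
  intros Ha. induction n as [|n IH]; [simpl; lra|]. cbn [shift_prod].
  assert (Hn := pos_INR n).
  apply Rmult_lt_0_compat; [exact IH|]. apply Rdiv_lt_0_compat; nra.
Qed.

Lemma Series_term_shift_prod (a : R) (n : nat) : 3 <= a ->
  Series (term a) = shift_prod a n * Series (term (a + 2 * INR n)).
Proof.
  intros Ha. induction n as [|n IH].
  - cbn [shift_prod]. simpl INR. replace (a + 2 * 0) with a by ring. ring.
  - assert (Hn := pos_INR n).
    rewrite IH, Series_term_shift by lra. rewrite S_INR. cbn [shift_prod].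
    replace (a + 2 * (INR n + 1)) with (a + 2 * INR n + 2) by ring. ring.
Qed.

Lemma Series_term_cvg (a : R) : 3 <= a ->
  is_lim_seq (fun n => Series (term (a + 2 * INR n))) (Series limit_term).
Proof.
  intros Ha.
  assert (L : is_lim_seq (fun n => 9 / (a + 2 * INR n) * Series majorant) 0).
  { replace (Finite 0) with (Finite (9 * 0 * Series majorant)) by (f_equal; ring).
    apply is_lim_seq_mult'; [|apply is_lim_seq_const].
    apply is_lim_seq_mult'; [apply is_lim_seq_const|].
    replace (Finite 0) with (Rbar_inv p_infty) by reflexivity.
    apply is_lim_seq_inv; [|discriminate].
    apply is_lim_seq_le_p_loc with (u := INR); [|apply is_lim_seq_INR].
    exists 0%nat. intros n _. generalize (pos_INR n). lra. }
  apply is_lim_seq_ext with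
    (fun n => Series limit_term + (Series (term (a + 2 * INR n)) - Series limit_term));
    [intros n; ring|].
  replace (Finite (Series limit_term)) with (Finite (Series limit_term + 0)) by (f_equal; ring).
  apply is_lim_seq_plus'; [apply is_lim_seq_const|].
  apply is_lim_seq_abs_0, is_lim_seq_le_le with (u := fun _ => 0) (2 := is_lim_seq_const 0) (3 := L).
  intros n. split; [apply Rabs_pos|]. apply Series_term_lim.
  generalize (pos_INR n). lra.
Qed.

Lemma Series_term_3 : Series (term 3) = 1.
Proof.
  rewrite Series_incr_1 by (apply ex_series_term; lra).
  rewrite (Series_ext _ (fun _ => 0 * 0)), Series_scal_l.
  - unfold term, fixed. rewrite varying_0. simpl. field.
  - intros k. unfold term, varying. rewrite (rising_S_l (3 - 3)). unfold Rdiv. ring.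
Qed.

(** Up to the factor [Series (term (16 / 3))], the quotient equals that of
    [Series (term (3 + 2 n))] by [Series (term (16 / 3 + 2 n))], two sequences with
    the same nonzero limit. *)
Lemma shift_prod_lim :
  is_lim_seq (fun n => shift_prod (16 / 3) n / shift_prod 3 n)
    (Series (term (16 / 3))).
Proof.
  assert (HA := Series_limit_term_pos).
  apply is_lim_seq_ext with (fun n =>
    Series (term (16 / 3)) * (Series (term (3 + 2 * INR n)) / Series (term (16 / 3 + 2 * INR n)))).
  - intros n.
    assert (E1 := Series_term_shift_prod (16 / 3) n ltac:(lra)).
    assert (E2 := Series_term_shift_prod 3 n ltac:(lra)). rewrite Series_term_3 in E2.
    assert (P := shift_prod_pos 3 n ltac:(lra)).
    assert (Q : 0 < Series (term (16 / 3 + 2 * INR n))).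
    { assert (Hn := pos_INR n).
      rewrite Series_incr_1 by (apply ex_series_term; lra).
      assert (0 <= Series (fun k => term (16 / 3 + 2 * INR n) (S k))).
      { replace 0 with (Series (fun _ => 0 * 0)) by (rewrite Series_scal_l; ring).
        apply Series_le.
        - intros k. generalize (term_le (16 / 3 + 2 * INR n) (S k) ltac:(lra)); lra.
        - apply (ex_series_incr_1 (term (16 / 3 + 2 * INR n))), ex_series_term; lra. }
      unfold term at 1, fixed. rewrite varying_0. simpl. lra. }
    rewrite E1. apply (Rmult_eq_reg_r (shift_prod 3 n)); [|lra].
    transitivity (shift_prod (16 / 3) n * (shift_prod 3 n * Series (term (3 + 2 * INR n)))).
    + field. lra.
    + rewrite <- E2. field. lra.
  - replace (Finite (Series (term (16 / 3)))) with
      (Finite (Series (term (16 / 3)) * (Series limit_term / Series limit_term)))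
      by (f_equal; field; lra).
    apply is_lim_seq_mult'; [apply is_lim_seq_const|].
    apply is_lim_seq_div'; try (apply Series_term_cvg; lra). lra.
Qed.

(** Going from [n] to [2 n] in these rising factorials applies the duplication
    formula [4 ^ n (x)_n (x + 1/2)_n = (2 x)_(2 n)], which removes the
    denominators 4 and 12 from the parameters of the two products.  Because
    [1/2 + 1 = 5/6 + 2/3], [dup_ratio] converges to a positive limit. *)
Definition dup_ratio (n : nat) : R :=
  rising (1 / 2) n * rising 1 n / (rising (5 / 6) n * rising (2 / 3) n).

Lemma dup_ratio_pos (n : nat) : 0 < dup_ratio n.
Proof.
  apply Rdiv_lt_0_compat; apply Rmult_lt_0_compat; apply rising_pos; lra.
Qed.

Lemma dup_ratio_S (n : nat) :
  dup_ratio (S n) = dup_ratio n * ((INR n + 1 / 2) * (INR n + 1) / ((INR n + 5 / 6) * (INR n + 2 / 3))).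
Proof.
  assert (Hn := pos_INR n). unfold dup_ratio; simpl.
  assert (H1 := rising_pos (5 / 6) n ltac:(lra)).
  assert (H2 := rising_pos (2 / 3) n ltac:(lra)). field. lra.
Qed.

(** [dup_ratio] decreases, yet so slowly that multiplication by [(n + 1) / (n + 2)]
    makes it increase. *)
Lemma dup_ratio_decr (n j : nat) :
  dup_ratio (n + j) <= dup_ratio n /\
  dup_ratio n * ((INR n + 1) / (INR n + 2)) <= dup_ratio (n + j) * ((INR (n + j) + 1) / (INR (n + j) + 2)).
Proof.
  induction j as [|j IH]; [rewrite Nat.add_0_r; lra|].
  rewrite Nat.add_succ_r, dup_ratio_S, S_INR. destruct IH as [I1 I2].
  assert (Hm := pos_INR (n + j)). assert (P := dup_ratio_pos (n + j)).
  set (m := INR (n + j)) in *. set (v := dup_ratio (n + j)) in *.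
  assert (Hd : 0 < (m + 5 / 6) * (m + 2 / 3)) by (apply Rmult_lt_0_compat; lra).
  split.
  - apply Rle_trans with (2 := I1). rewrite <- (Rmult_1_r v) at 2.
    apply Rmult_le_compat_l; [lra|]. apply Rle_div_l; nra.
  - apply Rle_trans with (1 := I2). rewrite Rmult_assoc. apply Rmult_le_compat_l; [lra|].
    assert (E : (m + 1 / 2) * (m + 1) / ((m + 5 / 6) * (m + 2 / 3)) * ((m + 1 + 1) / (m + 1 + 2))
      - (m + 1) / (m + 2)
      = (m + 1) * ((m + 1 / 2) * (m + 2) ^ 2 - (m + 5 / 6) * (m + 2 / 3) * (m + 3))
        / ((m + 5 / 6) * (m + 2 / 3) * (m + 3) * (m + 2))) by (field; lra).
    assert (0 <= (m + 1) * ((m + 1 / 2) * (m + 2) ^ 2 - (m + 5 / 6) * (m + 2 / 3) * (m + 3))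
        / ((m + 5 / 6) * (m + 2 / 3) * (m + 3) * (m + 2))); [|lra].
    apply Rdiv_le_0_compat.
    + apply Rmult_le_pos; [lra|]. nra.
    + repeat apply Rmult_lt_0_compat; lra.
Qed.

Lemma dup_ratio_lim : is_lim_seq (fun n => dup_ratio (2 * n) / dup_ratio n) 1.
Proof.
  apply is_lim_seq_le_le with (u := fun n => (INR n + 1) / (INR n + 2)) (w := fun _ => 1).
  - intros n. replace (2 * n)%nat with (n + n)%nat by lia.
    destruct (dup_ratio_decr n n) as [I1 I2]. assert (P := dup_ratio_pos n). assert (Q := dup_ratio_pos (n + n)).
    assert (Hn := pos_INR n). assert (Hm := pos_INR (n + n)). split.
    + apply (Rle_div_r _ _ (dup_ratio n)); [lra|]. rewrite Rmult_comm.
      apply Rle_trans with (dup_ratio (n + n) * ((INR (n + n) + 1) / (INR (n + n) + 2))); [lra|].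
      rewrite <- (Rmult_1_r (dup_ratio (n + n))) at 2. apply Rmult_le_compat_l; [lra|].
      apply Rle_div_l; lra.
    + apply Rle_div_l; lra.
  - apply lim_shift_ratio; lra.
  - apply is_lim_seq_const.
Qed.

(** What remains of [shift_prod_ratio] after the factors whose parameters differ by
    an integer have telescoped.  It tends to 1. *)
Definition telescoped (n : nat) : R :=
  let x := INR n in
  (x + 2 / 3) / (x + 3 / 2) * ((x + 2 / 3) / (x + 5 / 12)) * ((x + 5 / 3) / (x + 17 / 12))
  * ((x + 8 / 3) / (x + 11 / 12)) * ((x + 1 / 4) / (x + 23 / 12)) * ((x + 3 / 4) / (x + 1 / 3)).

(** By induction on [n]: the quotients of consecutive values agree as rational
    functions of [n].  The constant makes the two sides agree at [n = 0]. *)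
Lemma shift_prod_ratio (n : nat) :
  shift_prod (16 / 3) n / shift_prod 3 n
  = 4301 / 3072 * telescoped n * (dup_ratio (2 * n) / dup_ratio n) * sine_prod n.
Proof.
  assert (P := fun n => shift_prod_pos 3 n ltac:(lra)).
  induction n as [|n IH].
  - unfold telescoped, dup_ratio; simpl. field.
  - assert (Hn := pos_INR n). assert (Pn := P n). assert (W := dup_ratio_pos n).
    replace (2 * S n)%nat with (S (S (2 * n))) by lia.
    rewrite !dup_ratio_S, S_INR, mult_INR. simpl (INR 2). replace (1 + 1) with 2 by ring.
    set (x := INR n) in *.
    transitivity (shift_prod (16 / 3) n / shift_prod 3 n *
      ((x + 5 / 3) * (x + 11 / 3) * (x + 5 / 4) * (x + 7 / 4)
       / ((x + 29 / 12) * (x + 35 / 12) * (x + 1 / 2) * (x + 5 / 2)))).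
    + cbn [shift_prod]. fold x. field. repeat split; nra.
    + rewrite IH. cbn [sine_prod]. unfold telescoped. rewrite S_INR. fold x.
      field. repeat split; nra.
Qed.

Lemma Series_term_value : Series (term (16 / 3)) = 4301 * sqrt 3 / 4096.
Proof.
  assert (L : is_lim_seq (fun n => shift_prod (16 / 3) n / shift_prod 3 n) (4301 * sqrt 3 / 4096)).
  { apply is_lim_seq_ext with (fun n =>
      4301 / 3072 * telescoped n * (dup_ratio (2 * n) / dup_ratio n) * sine_prod n).
    { intros n. symmetry. apply shift_prod_ratio. }
    replace (4301 * sqrt 3 / 4096) with
      (4301 / 3072 * (1 * 1 * 1 * 1 * 1 * 1) * 1 * (3 * sqrt 3 / 4)) by field.
    apply is_lim_seq_mult'; [|exact sine_prod_lim].
    apply is_lim_seq_mult'; [|exact dup_ratio_lim].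
    apply is_lim_seq_mult'; [apply is_lim_seq_const|].
    unfold telescoped. repeat apply is_lim_seq_mult'; apply lim_shift_ratio; lra. }
  apply is_lim_seq_unique in L. assert (L' := is_lim_seq_unique _ _ shift_prod_lim).
  rewrite L in L'. congruence.
Qed.

Theorem mainTheorem19 :
  is_series
    (fun j : nat =>
       (1 / 4) ^ j
       * ((rising (3 / 2) j * rising (7 / 3) j * rising (8 / 3) j)
          / (rising 1 j * rising (29 / 12) j * rising (35 / 12) j))
       * (9 * INR j + 16))
    (4301 * sqrt 3 / 256).
Proof.
  replace (4301 * sqrt 3 / 256) with (16 * (4301 * sqrt 3 / 4096)) by field.
  rewrite <- Series_term_value.
  apply is_series_ext with (fun j => scal 16 (term (16 / 3) j)).
  - intros j. unfold term, fixed, varying.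
    replace (16 / 3 / 2 + 1 / 4) with (35 / 12) by field.
    replace (16 / 3 / 2 - 1 / 4) with (29 / 12) by field.
    replace (16 / 3 / 2) with (8 / 3) by field.
    replace (16 / 3 - 3) with (7 / 3) by field.
    assert (H1 := rising_pos 1 j ltac:(lra)).
    assert (H2 := rising_pos (29 / 12) j ltac:(lra)).
    assert (H3 := rising_pos (35 / 12) j ltac:(lra)).
    change (16 * ((1 + 3 * INR j / (16 / 3)) * (rising (3 / 2) j / rising 1 j)
      * ((1 / 4) ^ j * (rising (8 / 3) j * rising (7 / 3) j)
         / (rising (35 / 12) j * rising (29 / 12) j)))
      = (1 / 4) ^ j
       * ((rising (3 / 2) j * rising (7 / 3) j * rising (8 / 3) j)
          / (rising 1 j * rising (29 / 12) j * rising (35 / 12) j))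
       * (9 * INR j + 16)).
    field. lra.
  - apply (is_series_scal (V := R_NormedModule)), Series_correct, ex_series_term. lra.
Qed.
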